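(* D-APEP$\langle\mathsf{SoD},\mathsf{BoD}\rangle$ is fixed-parameter tractable (FPT) parameterized by the number $k=|R|$ of resources.
   Context: D-APEP. An instance consists of a finite set $U$ of users, a finite set $R$ of resources, a base authorization relation $A_{\sf Bse}\subseteq U\times R$ with $A_{\sf Bse}(r)\neq\emptyset$ for all $r\in R$, and a set $C$ of constraints. For $A\subseteq U\times R$, $A(r)=\{u\in U:(u,r)\in A\}$. $A$ is authorized if $A\subseteq A_{\sf Bse}$, complete if $A(r)\ne\emptyset$ for all $r\in R$, eligible if it satisfies every $c\in C$, and valid if it is authorized, complete and eligible. The problem is to decide whether a valid $A$ exists (and, if so, find one). Constraints. For $r,r'\in R$ and complete $A$: $(r,r',\leftrightarrow,\exists)$ is satisfied iff $A(r)\cap A(r')\neq\emptyset$; $(r,r',\leftrightarrow,\forall)$ iff $A(r)=A(r')$; $(r,r',\updownarrow,\exists)$ iff $A(r)\ne A(r')$; $(r,r',\updownarrow,\forall)$ iff $A(r)\cap A(r')=\emptyset$. $\mathsf{BoD}$ is the family of all constraints $(r,r',\leftrightarrow,\exists)$ and $(r,r',\leftrightarrow,\forall)$; $\mathsf{SoD}$ is the family of all constraints $(r,r',\updownarrow,\exists)$ and $(r,r',\updownarrow,\forall)$. D-APEP$\langle\mathsf{SoD},\mathsf{BoD}\rangle$ is the restriction to instances in which $C$ contains only $\mathsf{BoD}$ and $\mathsf{SoD}$ constraints. FPT parameterized by $k$ means solvable in time $O(g(k)\,p(N))$, where $N$ is the input size, $g$ is a computable function and $p$ a polynomial. *)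

(* Defs.v *)
From mathcomp Require Import all_boot all_order all_algebra.

Set Implicit Arguments.
Unset Strict Implicit.
Unset Printing Implicit Defensive.

(** * Model of computation

    Jones' language WHILE over binary trees, with its usual unit-cost measure
    (N. D. Jones, Computability and Complexity from a Programming Perspective).
    A tree is represented in memory by a pointer, so that consing, taking a
    component and copying are constant-time operations; WHILE and
    Turing machines simulate each other with polynomial overhead. *)

Inductive tree : Type := Leaf | Node of tree & tree.

Fixpoint tree_size (t : tree) : nat :=
  if t is Node a b then (tree_size a + tree_size b).+1 else 1.

Definition head_tree (t : tree) : tree := if t is Node a _ then a else Leaf.
Definition tail_tree (t : tree) : tree := if t is Node _ b then b else Leaf.

Inductive expr : Type :=
  | Var of nat
  | Nil
  | Cons of expr & expr
  | Hd of expr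
  | Tl of expr.

Inductive cmd : Type :=
  | Assign of nat & expr
  | Seq of cmd & cmd
  | While of expr & cmd.

Definition store : Type := nat -> tree.

Definition update (s : store) (x : nat) (v : tree) : store :=
  fun y => if y == x then v else s y.

Fixpoint eval (e : expr) (s : store) : tree :=
  match e with
  | Var x => s x
  | Nil => Leaf
  | Cons e1 e2 => Node (eval e1 s) (eval e2 s)
  | Hd e1 => head_tree (eval e1 s)
  | Tl e1 => tail_tree (eval e1 s)
  end.

Fixpoint eval_time (e : expr) : nat :=
  match e with
  | Var _ | Nil => 1
  | Cons e1 e2 => (eval_time e1 + eval_time e2).+1
  | Hd e1 | Tl e1 => (eval_time e1).+1
  end.

(** [exec c s s' t]: started in [s], [c] halts in [s'] after [t] time units.
    As a loop condition, [Leaf] is false and every other tree is true. *)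
Inductive exec : cmd -> store -> store -> nat -> Prop :=
  | ExecAssign x e s :
      exec (Assign x e) s (update s x (eval e s)) (eval_time e).+1
  | ExecSeq c1 c2 s s1 s2 t1 t2 :
      exec c1 s s1 t1 -> exec c2 s1 s2 t2 -> exec (Seq c1 c2) s s2 (t1 + t2)
  | ExecWhileFalse e c s :
      eval e s = Leaf -> exec (While e c) s s (eval_time e).+1
  | ExecWhileTrue e c s s1 s2 t1 t2 :
      eval e s <> Leaf -> exec c s s1 t1 -> exec (While e c) s1 s2 t2 ->
      exec (While e c) s s2 ((eval_time e).+1 + t1 + t2).

Lemma exec_deterministic c s s1 s2 t1 t2 :
  exec c s s1 t1 -> exec c s s2 t2 -> s1 = s2 /\ t1 = t2.
Proof.
move=> H; elim: H s2 t2 => {c s s1 t1}.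
- by move=> x e s s2 t2 H; inversion H; subst.
- move=> c1 c2 s s1 s1' t1 t1' _ IH1 _ IH2 s2 t2 H; inversion H; subst.
  match goal with E1 : exec c1 _ _ _, E2 : exec c2 _ _ _ |- _ =>
    case: (IH1 _ _ E1) E2 => <- <- /IH2 [<- <-] end.
  by [].
- by move=> e c s e0 s2 t2 H; inversion H; subst.
- move=> e c s s1 s1' t1 t1' e0 _ IH1 _ IH2 s2 t2 H; inversion H; subst => //.
  match goal with E1 : exec c _ ?u _, E2 : exec (While e c) ?u _ _ |- _ =>
    case: (IH1 _ _ E1) E2 => <- <- /IH2 [<- <-] end.
  by [].
Qed.

(** Variable 0 holds the input and, on termination, the output. *)
Definition init_store (v : tree) : store := update (fun=> Leaf) 0 v.

Definition run (c : cmd) (v w : tree) (t : nat) : Prop :=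
  exists2 s, exec c (init_store v) s t & s 0 = w.

(** * Encodings *)

Definition enc_bool (b : bool) : tree := if b then Node Leaf Leaf else Leaf.

(** Unary numerals. *)
Definition enc_nat (n : nat) : tree := iter n (Node Leaf) Leaf.

Definition enc_seq (T : Type) (enc : T -> tree) (s : seq T) : tree :=
  foldr (fun x t => Node (enc x) t) Leaf s.

Definition enc_option (T : Type) (enc : T -> tree) (o : option T) : tree :=
  if o is Some x then Node Leaf (enc x) else Leaf.

(** * Fixed-parameter tractability *)

Definition computable (g : nat -> nat) : Prop :=
  exists c : cmd, forall k, exists t, run c (enc_nat k) (enc_nat (g k)) t.

(** [answer x w]: [w] is a correct output on input [x]. *)
Definition fpt (X : Type) (enc : X -> tree) (param : X -> nat)
    (answer : X -> tree -> Prop) : Prop :=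
  exists (c : cmd) (g : nat -> nat) (p : {poly nat}) (K : nat),
    computable g /\
    forall x : X, exists (w : tree) (t : nat),
      [/\ run c (enc x) w t, answer x w
        & t <= K * (g (param x) * p.[tree_size (enc x)]%R)].

(** * D-APEP with SoD and BoD constraints *)

Section Policies.
Variables U R : finType.
Implicit Types (A B : {set U * R}) (r : R).

Definition users A r : {set U} := [set u | (u, r) \in A].

Inductive quantifier : Type := QExists | QForall.

(** [BoD r r' q] is (r, r', <->, q); [SoD r r' q] is (r, r', up-down arrow, q). *)
Inductive constraint : Type :=
  | BoD of R & R & quantifier
  | SoD of R & R & quantifier.

Definition satisfies A (c : constraint) : bool :=
  match c with
  | BoD r r' QExists => users A r :&: users A r' != set0
  | BoD r r' QForall => users A r == users A r'
  | SoD r r' QExists => users A r != users A r'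
  | SoD r r' QForall => users A r :&: users A r' == set0
  end.

Definition authorized B A : bool := A \subset B.
Definition complete A : bool := [forall r, users A r != set0].
Definition eligible (C : seq constraint) A : bool := all (satisfies A) C.

Definition valid B (C : seq constraint) A : bool :=
  [&& authorized B A, complete A & eligible C A].

End Policies.

(** Users and resources are named by initial segments of the naturals, and the
    set of constraints is given by an arbitrary list of its elements. *)
Record instance : Type := Instance {
  nb_users : nat;
  nb_resources : nat;
  base : {set 'I_nb_users * 'I_nb_resources};
  constraints : seq (constraint 'I_nb_resources);
  base_complete : forall r, users base r != set0
}.

(** Row-major Boolean incidence matrix, one row per user. *)
Definition enc_relation n k (A : {set 'I_n * 'I_k}) : tree :=
  enc_seq (fun u => enc_seq (fun r => enc_bool ((u, r) \in A)) (enum 'I_k))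
          (enum 'I_n).

Definition enc_quantifier (q : quantifier) : tree :=
  enc_bool (if q is QForall then true else false).

Definition enc_constraint k (c : constraint 'I_k) : tree :=
  match c with
  | BoD r r' q => Node (Node (enc_bool false) (enc_quantifier q))
                       (Node (enc_nat r) (enc_nat r'))
  | SoD r r' q => Node (Node (enc_bool true) (enc_quantifier q))
                       (Node (enc_nat r) (enc_nat r'))
  end.

Definition enc_instance (x : instance) : tree :=
  Node (Node (enc_nat (nb_users x)) (enc_nat (nb_resources x)))
       (Node (enc_relation (base x))
             (enc_seq (@enc_constraint _) (constraints x))).

(** A correct output is the answer "no" (encoded by [Leaf]) if there is no
    valid relation, and otherwise "yes" together with a valid relation. *)
Definition dapep_answer (x : instance) (w : tree) : Prop :=
  exists2 o : option {set 'I_(nb_users x) * 'I_(nb_resources x)},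
    w = enc_option (@enc_relation _ _) o
    & match o with
      | Some A => valid (base x) (constraints x) A
      | None => forall A, ~~ valid (base x) (constraints x) A
      end.

(* Main.v *)
From Pilot Require Import Defs.
From mathcomp Require Import all_boot all_order all_algebra.
From HB Require Import structures.
From mathcomp Require Import zify.

(** A relation gives every user a set of resources, a sub-row of the row of
    that user in the base relation, and the set of sub-rows that occur decides
    all the constraints as well as completeness. Dynamic programming over the
    users therefore keeps one partial relation for each family of sub-rows
    that can be realized: at most 2^2^k entries, each of which is extended in
    at most 2^k ways. A user or a constraint costs time bounded in k only, so
    the running time is at most a power of 2^2^k times the size of the
    instance. *)

(* Restores [Nil] and [Cons], which the abbreviations of seq shadow. *)
Import Pilot.Defs.

Set Implicit Arguments.
Unset Strict Implicit.
Unset Printing Implicit Defensive.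

(** Every constraint asserts or denies that some user has a row with a certain pattern on two bits:
    both set, or different. Completeness is the first pattern with the two bits equal to the same
    one. Adding a row changes the family in a way that depends on the family alone, so one witness
    per family is enough.

    The obstacle is that the claim concerns the running time of an actual WHILE program, in a
    language without conditionals, procedures, arithmetic or comparison of trees. Each program
    therefore comes with a [runs] statement that carries its result, an explicit time bound and a
    frame condition, and programs are assembled from combinators that preserve such statements.
    Comparing trees costs time, so families are stored as canonical lists and looked up by a
    comparison charged to the key.

    With M = 2^2^k, an insertion into the table costs O(M^3), and two enclosing loops make O(M^5)
    per user. The bound in k must itself be computed by a program, whence the exponent 8, the next
    power of two: M^8 = 2^2^(k+3) is two successive exponentials of a unary numeral. *)

(** * Programs working in place, and their combinators *)

Definition proc := nat -> cmd.

(* [f b] works in place on variable [b], and may destroy only the variables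
   from [b] on. *)
Definition runs (f : proc) (x y : tree) (B : nat) : Prop :=
  forall b s, s b = x -> exists s' t,
    [/\ exec (f b) s s' t, t <= B, s' b = y & forall i, i < b -> s' i = s i].

Lemma runs_le f x y B B' : runs f x y B -> B <= B' -> runs f x y B'.
Proof.
move=> Hf le b s sb; have [s' [t [Hc tB sb' fr]]] := Hf b s sb.
by exists s', t; split=> //; apply: leq_trans tB le.
Qed.

Lemma runs_run f x y B :
  runs f x y B -> exists2 t, run (f 0) x y t & t <= B.
Proof.
move=> Hf; have [|s' [t [Hc tB sb' _]]] := Hf 0 (init_store x); first by [].
by exists t => //; exists s'.
Qed.

Fixpoint subst_var (b : nat) (e : expr) : expr :=
  match e with
  | Var _ => Var b
  | Nil => Nil
  | Cons e1 e2 => Cons (subst_var b e1) (subst_var b e2)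
  | Hd e1 => Hd (subst_var b e1)
  | Tl e1 => Tl (subst_var b e1)
  end.

Lemma eval_subst b e s : eval (subst_var b e) s = eval e (fun=> s b).
Proof. by elim: e => //= [e1 -> e2 ->|e ->|e ->]. Qed.

Lemma eval_time_subst b e : eval_time (subst_var b e) = eval_time e.
Proof. by elim: e => //= [e1 -> e2 ->|e ->|e ->]. Qed.

(* Every variable of [e] stands for the argument. *)
Definition ret (e : expr) : proc := fun b => Assign b (subst_var b e).

Definition andthen (f g : proc) : proc := fun b => Seq (f b) (g b).

(** Nested lets turn the argument into a stack: the newest value is at [Hd], older ones and the
    original argument are reached through [Tl]. *)
Definition letp (f g : proc) : proc := fun b =>
  Seq (Assign b.+1 (Var b))
    (Seq (f b.+1) (Seq (Assign b (Cons (Var b.+1) (Var b))) (g b))).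

(* WHILE has no conditional: [b] and [b.+1] are flags for the two branches,
   and the first loop, when it runs, lowers both. *)
Definition ite (f g : proc) : proc := fun b =>
  Seq (Assign b.+2 (Tl (Var b)))
  (Seq (Assign b (Hd (Var b)))
  (Seq (Assign b.+1 (Cons Nil Nil))
  (Seq (Seq (While (Var b)
              (Seq (f b.+2) (Seq (Assign b Nil) (Assign b.+1 Nil))))
            (While (Var b.+1) (Seq (g b.+2) (Assign b.+1 Nil))))
       (Assign b (Var b.+2))))).

(** A list kept at the head of the argument drives the loop until it is exhausted. *)
Definition loop (f : proc) : proc := fun b => While (Hd (Var b)) (f b).

Lemma updateE s x v y : update s x v y = if y == x then v else s y.
Proof. by []. Qed.

Lemma runs_ret e x y : eval e (fun=> x) = y -> runs (ret e) x y (eval_time e).+1.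
Proof.
move=> ey b s sb; exists (update s b y), (eval_time e).+1; split=> //.
- by rewrite -(eval_time_subst b) -ey -sb -eval_subst; constructor.
- by rewrite updateE eqxx.
- by move=> i ib; rewrite updateE ltn_eqF.
Qed.

Lemma runs_then f g x y z B1 B2 :
  runs f x y B1 -> runs g y z B2 -> runs (andthen f g) x z (B1 + B2).
Proof.
move=> Hf Hg b s sb.
have [s1 [t1 [E1 l1 b1 fr1]]] := Hf b s sb.
have [s2 [t2 [E2 l2 b2 fr2]]] := Hg b s1 b1.
exists s2, (t1 + t2); split=> //; first exact: ExecSeq E1 E2.
- exact: leq_add.
- by move=> i ib; rewrite fr2 // fr1.
Qed.

Lemma runs_let f g x y z B1 B2 :
  runs f x y B1 -> runs g (Node y x) z B2 ->
  runs (letp f g) x z (B1 + B2 + 6).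
Proof.
move=> Hf Hg b s sb; set s0 := update s b.+1 x.
have [|s1 [t1 [E1 l1 b1 fr1]]] := Hf b.+1 s0; first by rewrite /s0 updateE eqxx.
have s1b : s1 b = x by rewrite fr1 // /s0 updateE ltn_eqF.
have [|s2 [t2 [E2 l2 b2 fr2]]] := Hg b (update s1 b (Node y x)).
  by rewrite updateE eqxx.
exists s2, (2 + (t1 + (4 + t2))); split=> //.
- apply: (@ExecSeq _ _ _ s0); first by have := ExecAssign b.+1 (Var b) s; rewrite /= sb.
  apply: ExecSeq E1 _; apply: ExecSeq E2.
  by have := ExecAssign b (Cons (Var b.+1) (Var b)) s1; rewrite /= b1 s1b.
- by lia.
- move=> i ib; rewrite fr2 // updateE ltn_eqF // fr1 1?ltnW //.
  by rewrite /s0 updateE ltn_eqF // ltnW.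
Qed.

(** The test is an arbitrary tree, so that emptiness of a list or of an option can be tested too.
    The overhead is 3 + 3 + 4 for the set-up, at most 10 for loop tests and flags, and 2 for the
    final copy. *)
Lemma runs_ite c f g v y B :
  (if c is Leaf then runs g v y B else runs f v y B) ->
  runs (ite f g) (Node c v) y (B + 22).
Proof.
move=> H b s sb.
set s1 := update s b.+2 v; set s2 := update s1 b c.
set s3 := update s2 b.+1 (Node Leaf Leaf).
have E1 : exec (Assign b.+2 (Tl (Var b))) s s1 3.
  by have := ExecAssign b.+2 (Tl (Var b)) s; rewrite /= sb.
have E2 : exec (Assign b (Hd (Var b))) s1 s2 3.
  have := ExecAssign b (Hd (Var b)) s1.
  by rewrite /= /s1 updateE ltn_eqF ?sb // ltnW.
have E3 : exec (Assign b.+1 (Cons Nil Nil)) s2 s3 4 by exact: ExecAssign.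
have s3b : s3 b = c by rewrite /s3 /s2 !updateE ltn_eqF // eqxx.
have s3b1 : s3 b.+1 = Node Leaf Leaf by rewrite /s3 updateE eqxx.
have s3b2 : s3 b.+2 = v.
  by rewrite /s3 /s2 /s1 !updateE eqxx !gtn_eqF //; lia.
have fr3 i : i < b -> s3 i = s i.
  by move=> ib; rewrite /s3 /s2 /s1 !updateE !ltn_eqF //; lia.
have [s' [t [E le sb' fr]]] : exists s' t,
    [/\ exec (Seq (While (Var b)
         (Seq (f b.+2) (Seq (Assign b Nil) (Assign b.+1 Nil))))
       (While (Var b.+1) (Seq (g b.+2) (Assign b.+1 Nil)))) s3 s' t,
      t <= B + 10, s' b.+2 = y & forall i, i < b -> s' i = s3 i].
  have [c0|[c1 [c2 c0]]] : c = Leaf \/ exists c1 c2, c = Node c1 c2.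
  - by case: (c) => [|c1 c2]; [left | right; exists c1, c2].
  - rewrite c0 in H s3b.
    have [s4 [t4 [E4 l4 b4 fr4]]] := H _ _ s3b2.
    exists (update s4 b.+1 Leaf), (2 + (2 + (t4 + 2) + 2)); split.
    - apply: ExecSeq; first exact: ExecWhileFalse.
      apply: ExecWhileTrue; first by rewrite /= s3b1.
        by apply: ExecSeq E4 _; apply: ExecAssign.
      by apply: ExecWhileFalse; rewrite /= updateE eqxx.
    - by lia.
    - by rewrite updateE gtn_eqF.
    - by move=> i ib; rewrite updateE ltn_eqF ?fr4 //; lia.
  rewrite c0 in H s3b.
  have [s4 [t4 [E4 l4 b4 fr4]]] := H _ _ s3b2.
  exists (update (update s4 b Leaf) b.+1 Leaf), (2 + (t4 + (2 + 2)) + 2 + 2); split.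
  - apply: ExecSeq.
      apply: ExecWhileTrue; first by rewrite /= s3b.
        by apply: ExecSeq E4 _; apply: ExecSeq; apply: ExecAssign.
      by apply: ExecWhileFalse; rewrite /= !updateE eqxx ltn_eqF.
    by apply: ExecWhileFalse; rewrite /= updateE eqxx.
  - by lia.
  - by rewrite !updateE !gtn_eqF //; lia.
  - by move=> i ib; rewrite !updateE !ltn_eqF ?fr4 //; lia.
eexists (update s' b y), _; split.
- apply: ExecSeq E1 _; apply: ExecSeq E2 _; apply: ExecSeq E3 _.
  apply: ExecSeq E _.
  by have := ExecAssign b (Var b.+2) s'; rewrite /= sb'; apply.
- by rewrite /=; lia.
- by rewrite updateE eqxx.
- by move=> i ib; rewrite updateE ltn_eqF ?fr ?fr3.
Qed.

Lemma runs_if (c : bool) f g v y z B :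
  runs f v y B -> runs g v z B ->
  runs (ite f g) (Node (enc_bool c) v) (if c then y else z) (B + 22).
Proof. by move=> Hf Hg; apply: runs_ite; case: c. Qed.

Lemma runs_loop_end f v : runs (loop f) (Node Leaf v) (Node Leaf v) 3.
Proof.
move=> b s sb; exists s, 3; split=> //.
by apply: ExecWhileFalse; rewrite /= sb.
Qed.

Lemma runs_loop_step f x y z B1 B2 :
  head_tree x <> Leaf -> runs f x y B1 -> runs (loop f) y z B2 ->
  runs (loop f) x z (B1 + B2 + 3).
Proof.
move=> xN Hf Hl b s sb.
have [s1 [t1 [E1 l1 b1 fr1]]] := Hf b s sb.
have [s2 [t2 [E2 l2 b2 fr2]]] := Hl b s1 b1.
exists s2, (3 + t1 + t2); split=> //.
- by apply: ExecWhileTrue E1 E2; rewrite /= sb.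
- by lia.
- by move=> i ib; rewrite fr2 // fr1.
Qed.

Local Notation x0 := (Var 0).

(* [fold f] iterates [f] on arguments (element, (accumulator, environment)). *)
Definition fold (f : proc) : proc :=
  andthen (loop (letp (andthen (ret (Cons (Hd (Hd x0)) (Tl x0))) f)
    (ret (Cons (Tl (Hd (Tl x0))) (Cons (Hd x0) (Tl (Tl (Tl x0))))))))
  (ret (Hd (Tl x0))).

Section Fold.
Variables (T A : Type) (encT : T -> tree) (encA : A -> tree).
Variables (op : A -> T -> A) (f : proc) (env : tree) (B : nat).

(* The invariant may mention the elements that are still to be processed. *)
Lemma runs_fold_ind (I : seq T -> A -> Prop) s a :
  (forall x s a, I (x :: s) a -> I s (op a x) /\
    runs f (Node (encT x) (Node (encA a) env)) (encA (op a x)) B) ->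
  I s a ->
  runs (fold f) (Node (enc_seq encT s) (Node (encA a) env))
    (encA (foldl op a s)) (size s * (B + 30) + 10).
Proof.
move=> opP Ia.
suff: exists2 v, head_tree (tail_tree v) = encA (foldl op a s)
  & runs (loop (letp (andthen (ret (Cons (Hd (Hd x0)) (Tl x0))) f)
    (ret (Cons (Tl (Hd (Tl x0))) (Cons (Hd x0) (Tl (Tl (Tl x0))))))))
  (Node (enc_seq encT s) (Node (encA a) env)) v (size s * (B + 30) + 3).
  case=> v vE H; apply: (runs_le (runs_then H (runs_ret _))); last by rewrite /=; lia.
  by rewrite /= vE.
elim: s a Ia => [|x s IH] a Ia /=.
  by exists (Node Leaf (Node (encA a) env)) => //; apply: runs_loop_end.
have [Ia' Hf] := opP _ _ _ Ia.
have [v vE Hv] := IH _ Ia'; exists v => //.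
apply: runs_le.
  apply: runs_loop_step Hv => //.
  apply: runs_let; last exact: runs_ret.
  apply: runs_then; first exact: runs_ret.
  exact: Hf.
by rewrite /=; lia.
Qed.

Lemma runs_fold (I : A -> Prop) (Q : pred T) s a :
  (forall a x, I a -> Q x -> I (op a x) /\
    runs f (Node (encT x) (Node (encA a) env)) (encA (op a x)) B) ->
  I a -> all Q s ->
  runs (fold f) (Node (enc_seq encT s) (Node (encA a) env))
    (encA (foldl op a s)) (size s * (B + 30) + 10).
Proof.
move=> opP Ia Qs; apply: (@runs_fold_ind (fun s a => all Q s /\ I a)) => //.
move=> x {}s {Ia Qs}a [/= /andP[Qx Qs] Ia].
by have [] := opP a x Ia Qx.
Qed.

Lemma runs_fold_all s a :
  (forall a x, runs f (Node (encT x) (Node (encA a) env)) (encA (op a x)) B) ->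
  runs (fold f) (Node (enc_seq encT s) (Node (encA a) env))
    (encA (foldl op a s)) (size s * (B + 30) + 10).
Proof. by move=> opP; apply: (@runs_fold (fun=> True) predT) => //; rewrite all_predT. Qed.
End Fold.

(** * Equality test on trees *)

Fixpoint tree_eqb (a b : tree) : bool :=
  match a, b with
  | Leaf, Leaf => true
  | Node a1 a2, Node b1 b2 => tree_eqb a1 b1 && tree_eqb a2 b2
  | _, _ => false
  end.

Lemma tree_eqbP : Equality.axiom tree_eqb.
Proof.
move=> a b; apply: (iffP idP) => [|<-]; last by elim: a => //= a -> b' ->.
elim: a b => [|a1 IH1 a2 IH2] [|b1 b2] //= /andP[/IH1 -> /IH2 -> //].
Qed.

HB.instance Definition _ := hasDecEq.Build tree tree_eqbP.

Definition true_expr := Cons Nil Nil.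

(* The argument of the loop is a stack of pairs still to be compared together
   with the answer; a mismatch empties the stack. *)
Definition eq_step : proc :=
  andthen (ret (Cons (Hd (Hd (Hd x0))) (Cons (Tl (Hd (Hd x0))) x0)))
  (ite
    (ite (ret (Cons (Cons (Cons (Hd (Hd (Hd (Hd x0)))) (Hd (Tl (Hd (Hd x0)))))
                    (Cons (Cons (Tl (Hd (Hd (Hd x0)))) (Tl (Tl (Hd (Hd x0)))))
                          (Tl (Hd x0)))) (Tl x0)))
         (ret (Cons Nil Nil)))
    (ite (ret (Cons Nil Nil)) (ret (Cons (Tl (Hd x0)) (Tl x0))))).

Definition treeqp : proc :=
  andthen (ret (Cons (Cons x0 Nil) true_expr)) (andthen (loop eq_step) (ret (Tl x0))).

(** Induction on the total size of the left components: a pair of nodes becomes two pairs of total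
    size one less, a pair of leaves disappears, and a mismatch ends the loop. As only the left side
    is charged, a lookup later costs, per entry, an amount that depends on the key alone. *)
Lemma runs_eq_loop (ps : seq (tree * tree)) :
  runs (loop eq_step)
    (Node (enc_seq (fun p => Node p.1 p.2) ps) (enc_bool true))
    (Node Leaf (enc_bool (all (fun p => p.1 == p.2) ps)))
    ((\sum_(p <- ps) tree_size p.1) * 200 + 6).
Proof.
have stop : runs (loop eq_step) (Node Leaf Leaf) (Node Leaf Leaf) 3.
  exact: runs_loop_end.
have [m le_m] := ubnP (\sum_(p <- ps) tree_size p.1).
elim: m ps le_m => // m IH [|[a b] ps].
  by move=> _; apply: (runs_le (@runs_loop_end _ _)); rewrite big_nil.
rewrite big_cons /= => le_m.
case: a b le_m => [|a1 a2] [|b1 b2] /= le_m.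
- apply: runs_le.
    apply: runs_loop_step => //.
      apply: runs_then; first exact: runs_ret.
      by do 2![apply: runs_ite => /=]; apply: runs_ret.
    by apply: IH; lia.
  by rewrite /=; lia.
- apply: runs_le.
    apply: runs_loop_step stop => //.
    apply: runs_then; first exact: runs_ret.
    by do 2![apply: runs_ite => /=]; apply: runs_ret.
  by rewrite /=; lia.
- apply: runs_le.
    apply: runs_loop_step stop => //.
    apply: runs_then; first exact: runs_ret.
    by do 2![apply: runs_ite => /=]; apply: runs_ret.
  by rewrite /=; lia.
have := IH [:: (a1, b1), (a2, b2) & ps].
rewrite !big_cons /= => /(_ ltac:(lia)) Hr; rewrite andbA in Hr.
apply: runs_le.
  apply: runs_loop_step Hr => //.
  apply: runs_then; first exact: runs_ret.
  by do 2![apply: runs_ite => /=]; apply: runs_ret.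
by rewrite /=; lia.
Qed.

Lemma runs_eq a b :
  runs treeqp (Node a b) (enc_bool (a == b)) (tree_size a * 200 + 20).
Proof.
have := @runs_eq_loop [:: (a, b)]; rewrite big_seq1 /= andbT => H.
apply: runs_le.
  apply: runs_then; first exact: runs_ret.
  by apply: runs_then H _; apply: runs_ret.
by rewrite /=; lia.
Qed.

Ltac ret_le := apply: runs_le; [exact: runs_ret | by rewrite /=; lia].

(** * Encodings of rows and families *)

Definition enc_row := enc_seq enc_bool.
Definition enc_fam := enc_seq enc_row.

(** A numeral is a list of units, so [fold] also serves as bounded iteration. *)
Lemma enc_natE n : enc_nat n = enc_seq (fun _ : unit => Leaf) (nseq n tt).
Proof. by elim: n => //= n ->. Qed.

Lemma enc_bool_inj : injective enc_bool.
Proof. by case=> [] []. Qed.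

Lemma enc_seq_inj (T : Type) (enc : T -> tree) :
  injective enc -> injective (enc_seq enc).
Proof. by move=> inj; elim=> [|x s IH] [|y t] //= [/inj -> /IH ->]. Qed.

Lemma enc_row_inj : injective enc_row.
Proof. exact: enc_seq_inj enc_bool_inj. Qed.

Lemma enc_fam_inj : injective enc_fam.
Proof. exact: enc_seq_inj enc_row_inj. Qed.

Lemma enc_seq_map (T T' : Type) (enc : T' -> tree) (h : T -> T') s :
  enc_seq enc (map h s) = enc_seq (enc \o h) s.
Proof. by elim: s => //= x s ->. Qed.

Lemma tree_size_row s : tree_size (enc_row s) <= 4 * size s + 1.
Proof. by elim: s => //= b s IH; rewrite /= -/enc_row; case: b => /=; lia. Qed.

Lemma tree_size_fam k S :
  all (fun X => size X == k) S -> tree_size (enc_fam S) <= size S * (4 * k + 2) + 1.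
Proof.
elim: S => //= X S IH /andP[/eqP Xk /IH].
by have := tree_size_row X; rewrite Xk /= -/enc_fam; lia.
Qed.

(** * List programs *)

Definition revp : proc :=
  andthen (ret (Cons x0 (Cons Nil Nil))) (fold (ret (Cons (Hd x0) (Hd (Tl x0))))).

Lemma foldl_rcons_rev (T : Type) (s acc : seq T) :
  foldl (fun a x => x :: a) acc s = rev s ++ acc.
Proof. by elim: s acc => //= x s IH acc; rewrite IH rev_cons cat_rcons. Qed.

Lemma runs_rev (T : Type) (enc : T -> tree) s :
  runs revp (enc_seq enc s) (enc_seq enc (rev s)) (size s * 40 + 20).
Proof.
rewrite -[rev s]cats0 -foldl_rcons_rev.
apply: runs_le.
  apply: runs_then; first exact: runs_ret.
  apply: (@runs_fold_all _ _ enc (enc_seq enc) _ _ Leaf 7 s [::]) => a x.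
  exact: runs_ret.
by rewrite /=; lia.
Qed.

(** The projection [key] is the identity for a family of rows, and [Hd] for a table searched by its
    families. *)
Definition memp (key : expr -> expr) : proc :=
  andthen (ret (Cons (Hd x0) (Cons Nil (Tl x0))))
  (fold (andthen (ret (Cons (Hd (Tl x0)) (Cons (Tl (Tl x0)) (key (Hd x0)))))
          (ite (ret true_expr) treeqp))).

Lemma foldl_has (T : Type) (a : pred T) b s :
  foldl (fun acc x => acc || a x) b s = b || has a s.
Proof. by elim: s b => [|x s IH] b /=; rewrite ?orbF // IH orbA. Qed.

Lemma foldl_all (T : Type) (a : pred T) b s :
  foldl (fun acc x => acc && a x) b s = b && all a s.
Proof. by elim: s b => [|x s IH] b /=; rewrite ?andbT // IH andbA. Qed.

Lemma runs_mem (key : expr -> expr) (T : Type) (enc k : T -> tree) s x :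
  (forall y v, eval (key (Hd x0)) (fun=> Node (enc y) v) = k y) ->
  eval_time (key (Hd x0)) <= 4 ->
  runs (memp key) (Node (enc_seq enc s) x) (enc_bool (has (fun y => x == k y) s))
    (size s * (tree_size x * 200 + 100) + 50).
Proof.
move=> keyE keyT.
rewrite -[has _ _]orFb -foldl_has.
apply: runs_le.
  apply: runs_then; first exact: runs_ret.
  apply: (@runs_fold_all _ _ enc enc_bool _ _ _ (tree_size x * 200 + 60) s false) => a y.
  apply: runs_le.
    apply: runs_then; first by apply: runs_ret; rewrite /= keyE.
    apply: (@runs_ite _ _ _ _ _ (tree_size x * 200 + 20)).
    case: a => /=; last exact: runs_eq.
    by apply: (@runs_le _ _ _ 4); [exact: runs_ret | lia].
  by rewrite /=; lia.
by rewrite /=; lia.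
Qed.

(** * Used families *)

(** The pair of a row [T] and a family [S], used as environment, is at the same time the encoding of
    the list [T :: S] in which the rows of [full] are looked up. *)
Definition updp : proc :=
  andthen (ret (Cons (Tl (Tl x0)) (Cons Nil (Cons (Hd x0) (Hd (Tl x0))))))
  (fold (letp (andthen (ret (Cons (Tl (Tl x0)) (Hd x0))) (memp id))
    (andthen (ret (Cons (Hd x0) (Cons (Hd (Tl x0)) (Hd (Tl (Tl x0))))))
      (ite (ret x0) (ret (Tl x0)))))).

(* The states of the dynamic program: [full] lists all rows, so equal families
   become equal lists. *)
Definition fam_of (full S : seq (seq bool)) : seq (seq bool) :=
  rev [seq X <- full | X \in S].

Lemma foldl_filter (T : Type) (a : pred T) acc s :
  foldl (fun acc x => if a x then x :: acc else acc) acc s = rev (filter a s) ++ acc.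
Proof.
elim: s acc => //= x s IH acc; rewrite IH; case: (a x) => //.
by rewrite rev_cons cat_rcons.
Qed.

Lemma has_enc (T : eqType) (enc : T -> tree) x s :
  injective enc -> has (fun y => enc x == enc y) s = (x \in s).
Proof.
move=> inj; rewrite -has_pred1; apply: eq_has => y /=.
by rewrite (inj_eq inj) eq_sym.
Qed.

Lemma runs_upd k full T S :
  all (fun X => size X == k) full ->
  runs updp (Node (enc_row T) (Node (enc_fam S) (enc_fam full)))
    (enc_fam (fam_of full (T :: S)))
    (size full * ((size S).+1 * (800 * k + 300) + 150) + 40).
Proof.
move=> fullk.
(* The reversal in [fam_of] is the order in which the fold accumulates. *)
rewrite /fam_of -[rev _]cats0 -foldl_filter.
apply: runs_le.
  apply: runs_then; first exact: runs_ret.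
  apply: (@runs_fold _ _ enc_row enc_fam _ _ _ ((size S).+1 * (800 * k + 300) + 110)
     (fun=> True) (fun X => size X == k) full [::]) => //= acc X _ /eqP Xk.
  split=> //; apply: runs_le.
    apply: runs_let.
      apply: runs_then; first exact: runs_ret.
      by apply: (@runs_mem _ _ enc_row enc_row (T :: S) (enc_row X)).
    apply: runs_then; first exact: runs_ret.
    rewrite fun_if.
    rewrite (has_enc _ _ enc_row_inj).
    by apply: (@runs_if _ _ _ _ _ _ 3); ret_le.
  have := tree_size_row X; rewrite Xk /= => le.
  have: (size S).+1 * (tree_size (enc_row X) * 200 + 100) <= (size S).+1 * (800 * k + 300).
    by rewrite leq_mul2l /=; lia.
  by lia.
by rewrite /=; lia.
Qed.

(** * Sub-rows *)

Definition ext (acc : seq (seq bool)) (b : bool) : seq (seq bool) :=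
  foldl (fun res X => if b then [:: true :: X, false :: X & res]
                      else (false :: X) :: res) [::] acc.

Definition subs (s : seq bool) : seq (seq bool) := foldl ext [:: [::]] (rev s).

Definition extp : proc :=
  andthen (ret (Cons (Hd (Tl x0)) (Cons Nil (Hd x0))))
   (fold (andthen (ret (Cons (Tl (Tl x0)) x0))
     (ite (ret (Cons (Cons true_expr (Hd x0)) (Cons (Cons Nil (Hd x0)) (Hd (Tl x0)))))
          (ret (Cons (Cons Nil (Hd x0)) (Hd (Tl x0))))))).

Definition subsp : proc :=
  andthen revp (andthen (ret (Cons x0 (Cons (Cons Nil Nil) Nil))) (fold extp)).

Lemma runs_ext acc b v :
  runs extp (Node (enc_bool b) (Node (enc_fam acc) v)) (enc_fam (ext acc b))
    (size acc * 100 + 30).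
Proof.
apply: runs_le.
  apply: runs_then; first exact: runs_ret.
  apply: (@runs_fold_all _ _ enc_row enc_fam _ _ (enc_bool b) 60 acc [::]) => a X.
  apply: runs_le.
    apply: runs_then; first exact: runs_ret.
    rewrite fun_if; by apply: (@runs_if _ _ _ _ _ _ 20); ret_le.
  by [].
by rewrite /=; lia.
Qed.

Lemma size_ext acc b : size (ext acc b) <= 2 * size acc.
Proof.
rewrite /ext -[2 * _]addn0 -[X in _ + X]/(size ([::] : seq (seq bool))).
elim: acc [::] => //= X acc IH res.
by apply: leq_trans (IH _) _; case: b {IH} => /=; lia.
Qed.

Lemma size_foldl_ext acc s : size (foldl ext acc s) <= size acc * 2 ^ size s.
Proof.
elim: s acc => [|b s IH] acc /=; first by rewrite muln1.
apply: leq_trans (IH _) _; rewrite expnS mulnA leq_mul2r [_ * 2]mulnC size_ext.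
by rewrite orbT.
Qed.

Lemma size_subs s : size (subs s) <= 2 ^ size s.
Proof. by rewrite /subs -[X in _ <= 2 ^ X]size_rev -[X in _ <= X]mul1n size_foldl_ext. Qed.

Lemma runs_subs s :
  runs subsp (enc_row s) (enc_fam (subs s)) (size s * (2 ^ size s * 100 + 100) + 50).
Proof.
apply: runs_le.
  apply: runs_then; first exact: runs_rev.
  apply: runs_then; first exact: runs_ret.
  (* Each remaining bit at most doubles the accumulator, so this invariant bounds every intermediate
     size by 2 ^ size s. *)
  apply: (@runs_fold_ind _ _ enc_bool enc_fam _ _ Leaf (2 ^ size s * 100 + 30)
     (fun t acc => size acc * 2 ^ size t <= 2 ^ size s) (rev s) [:: [::]]); last first.
    by rewrite size_rev mul1n.
  move=> b t acc /= le; split.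
    apply: leq_trans le; rewrite expnS mulnA leq_mul2r [_ * 2]mulnC size_ext.
    by rewrite orbT.
  apply: runs_le; first exact: runs_ext.
  have := leq_mul (leqnn (size acc)) (expn_gt0 2 (size t).+1); lia.
by rewrite size_rev /=; lia.
Qed.

Lemma mem_ext acc b X :
  (X \in ext acc b) = (ohead X \in (if b then [:: Some true; Some false] else [:: Some false]))
    && (behead X \in acc).
Proof.
rewrite /ext -[RHS]orbF -[X in _ || X]/(X \in [::]).
elim: acc [::] => [|Y acc IH] res /=; first by rewrite in_nil andbF.
rewrite IH; case: b {IH} => /=; rewrite !inE; case: X => [|[] X] //=;
 rewrite ?eqseq_cons ?(orbF, andbF) //=;
 do ?case: (_ == _); do ?case: (_ \in _); rewrite ?orbT //.
Qed.

Lemma mem_subs s X :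
  (X \in subs s) = (size X == size s) && all2 implb X s.
Proof.
rewrite /subs foldl_rev; elim: s X => [|b s IH] [|c X] //=; rewrite mem_ext //= IH.
  by case: b; rewrite !inE.
by case: b c => [] [] /=; rewrite ?inE /= ?eqSS ?andbF.
Qed.

(** * Dynamic programming over the users *)

(** A family, and a witness for it: one chosen sub-row for each user treated so far. *)
Definition entry := (seq (seq bool) * seq (seq bool))%type.

Definition enc_entry (e : entry) := Node (enc_fam e.1) (enc_fam e.2).

(** Witnesses of the same family are interchangeable, so the first one is kept. *)
Definition insert (tab : seq entry) (e : entry) :=
  if e.1 \in map fst tab then tab else e :: tab.

Definition candidates full (row : seq bool) (e : entry) :=
  [seq (fam_of full (X :: e.1), X :: e.2) | X <- subs row].

Definition step full (tab : seq entry) (row : seq bool) :=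
  foldl (fun acc e => foldl insert acc (candidates full row e)) [::] tab.

(** Users are treated from the last to the first, so that prefixing a choice keeps each witness
    aligned with [rows]. *)
Definition table full rows := foldl (step full) [:: ([::], [::])] (rev rows).

Lemma step_flatten full tab row :
  step full tab row = foldl insert [::] (flatten [seq candidates full row e | e <- tab]).
Proof.
rewrite /step; elim: tab [::] => //= e tab IH acc.
by rewrite foldl_cat IH.
Qed.

Lemma mem_foldl_insert acc s e :
  e \in foldl insert acc s -> (e \in acc) || (e \in s).
Proof.
elim: s acc => [|x s IH] acc /=; first by move=> ->.
move/IH; rewrite /insert inE; case: ifP => _; rewrite ?inE;
 by case: (e == x); rewrite ?orbT.
Qed.

(** Insertion may drop a candidate but never its family, hence an equality here and only an
    implication in [mem_foldl_insert]. *)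
Lemma key_foldl_insert acc s S :
  (S \in map fst (foldl insert acc s)) = (S \in map fst acc) || (S \in map fst s).
Proof.
elim: s acc => [|x s IH] acc /=; first by rewrite orbF.
rewrite IH /insert inE; case: ifP => [xin|_] /=; last by rewrite inE orbCA orbA.
by case: eqVneq => [->|]; rewrite ?xin ?orbT.
Qed.

(** A device for counting that no program computes: masks are the sub-rows of an all-true row, so
    [size_subs] bounds their number. *)
Definition states (full : seq (seq bool)) :=
  [seq rev (mask m full) | m <- subs (nseq (size full) true)].

Lemma fam_of_state full S : fam_of full S \in states full.
Proof.
apply/mapP; exists (map (mem S) full); last by rewrite -filter_mask.
rewrite mem_subs size_map size_nseq eqxx /=.
by elim: full => //= X s ->; rewrite implybT.
Qed.

Lemma size_state full S : S \in states full -> size S <= size full.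
Proof.
case/mapP=> m; rewrite mem_subs size_nseq => /andP[/eqP sm _] ->.
by rewrite size_rev size_mask // -sm count_size.
Qed.

Lemma all_state (a : pred (seq bool)) full S :
  all a full -> S \in states full -> all a S.
Proof.
by move=> af /mapP[m _ ->]; rewrite all_rev; apply: all_mask.
Qed.

(** The invariant that bounds the length of a table independently of the number of users. *)
Definition good full (tab : seq entry) :=
  uniq (map fst tab) && all (mem (states full)) (map fst tab).

Lemma size_good full tab : good full tab -> size tab <= 2 ^ size full.
Proof.
case/andP=> Ut /allP st; rewrite -(size_map fst).
apply: leq_trans (uniq_leq_size Ut st) _; rewrite size_map.
by rewrite -[X in _ <= 2 ^ X](size_nseq _ true) size_subs.
Qed.

Lemma good_insert full tab S w :
  S \in states full -> good full tab -> good full (insert tab (S, w)).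
Proof.
by rewrite /good /insert => Sst; case: ifP => //= -> /andP[-> ->]; rewrite Sst.
Qed.

Lemma good_candidates full row tab e :
  good full tab -> good full (foldl insert tab (candidates full row e)).
Proof.
rewrite /candidates; elim: (subs row) tab => //= X s IH tab gt.
by apply/IH/good_insert => //; apply: fam_of_state.
Qed.

Lemma good_step full tab row : good full (step full tab row).
Proof.
rewrite /step; elim: tab ([::] : seq entry) (erefl : good full [::]) => //= e tab IH acc ga.
by apply/IH/good_candidates.
Qed.

Lemma good_init full : good full [:: ([::], [::])].
Proof.
rewrite /good /= andbT -[ [::] ]/(rev [::]) -(filter_pred0 full).
exact: fam_of_state [::].
Qed.

Lemma good_table full rows : good full (table full rows).
Proof.
rewrite /table; elim: (rev rows) [:: _] (good_init full) => //= r s IH t _.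
exact/IH/good_step.
Qed.

(** This is what makes the dynamic program correct: the next state depends on the earlier choices
    only through their family. *)
Lemma fam_of_cons full X w : fam_of full (X :: fam_of full w) = fam_of full (X :: w).
Proof.
congr rev; apply: eq_in_filter => Y Yfull.
by rewrite !inE mem_rev mem_filter Yfull andbT.
Qed.

Definition choice_of (w rows : seq (seq bool)) := all2 (fun X row => X \in subs row) w rows.

Lemma tableS full row rows : table full (row :: rows) = step full (table full rows) row.
Proof. by rewrite /table rev_cons -cats1 foldl_cat. Qed.

Lemma table_sound full rows S w :
  (S, w) \in table full rows -> choice_of w rows /\ S = fam_of full w.
Proof.
elim: rows S w => [|row rows IH] S w.
  by rewrite /table inE => /eqP[-> ->]; rewrite /fam_of filter_pred0.
rewrite tableS step_flatten => /mem_foldl_insert; rewrite in_nil /=.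
case/flatten_mapP=> [[S' w']] /IH[cw ->] /mapP[X Xr [-> ->]] /=.
by rewrite Xr fam_of_cons.
Qed.

(** The choice [w] itself may be missing, because another witness of its family came first; the
    induction goes on with that witness in place of the tail of [w]. *)
Lemma table_complete full rows w :
  choice_of w rows -> fam_of full w \in map fst (table full rows).
Proof.
elim: rows w => [|row rows IH] [|X w] //=.
  by rewrite /table inE /fam_of filter_pred0.
case/andP=> Xr /IH /mapP[[S' w'] e' /= ES]; rewrite tableS step_flatten.
rewrite key_foldl_insert -fam_of_cons ES.
apply/mapP; exists (fam_of full (X :: S'), X :: w') => //.
by apply/flatten_mapP; exists (S', w') => //; apply: map_f.
Qed.

(** * Programs for one step of the dynamic program, and their cost *)

Definition insp : proc :=
  letp (andthen (ret (Cons (Hd x0) (Cons (Hd (Hd (Tl (Tl x0)))) (Tl (Tl (Tl x0)))))) updp)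
  (letp (andthen (ret (Cons (Hd (Tl (Tl x0))) (Hd x0))) (memp Hd))
  (andthen (ret (Cons (Hd x0) (Cons (Hd (Tl (Tl (Tl x0))))
      (Cons (Cons (Hd (Tl x0)) (Cons (Hd (Tl (Tl x0))) (Tl (Hd (Tl (Tl (Tl (Tl x0))))))))
            (Hd (Tl (Tl (Tl x0))))))))
    (ite (ret (Hd x0)) (ret (Tl x0))))).

(** The sub-rows are computed once per user and travel in the environment of the outer fold. *)
Definition stepp : proc :=
  letp (andthen (ret (Hd x0)) subsp)
  (andthen (ret (Cons (Hd (Tl (Tl x0))) (Cons Nil (Cons (Hd x0) (Tl (Tl (Tl x0)))))))
  (fold (andthen
    (ret (Cons (Hd (Tl (Tl x0))) (Cons (Hd (Tl x0)) (Cons (Hd x0) (Tl (Tl (Tl x0)))))))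
    (fold insp)))).

Lemma leq_cost C d e M : 0 < M -> d <= e -> C * M ^ d <= C * M ^ e.
Proof. by move=> M0 de; rewrite leq_mul2l leq_pexp2l // orbT. Qed.

Lemma foldl_map (T1 T2 A : Type) (h : T1 -> T2) (f : A -> T2 -> A) a s :
  foldl f a (map h s) = foldl (fun a x => f a (h x)) a s.
Proof. by elim: s a => /=. Qed.

(** A fold over at most [M] elements raises the degree by one; 40 absorbs the overhead 30 per round
    and the final 10. *)
Lemma fold_cost M n B C d : 0 < M -> n <= M -> B <= C * M ^ d ->
  n * (B + 30) + 10 <= (C + 40) * M ^ d.+1.
Proof.
move=> M_gt0 nM BC; have Md : 0 < M ^ d by rewrite expn_gt0 M_gt0.
have := leq_mul nM (leq_add BC (leq_mul (leqnn 30) Md)).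
rewrite expnS; have := leq_mul M_gt0 Md; lia.
Qed.

Section Bounds.
Variables (k M : nat) (full : seq (seq bool)).
Hypotheses (M_gt0 : 0 < M) (k_le : k <= M) (full_le : size full <= M).
Hypothesis tab_le : 2 ^ size full <= M.
Hypothesis row_le : 2 ^ k <= M.
Hypothesis full_k : all (fun X => size X == k) full.

(** Updating the family compares at most M rows with at most M + 1 others, each comparison costing
    O(k). Searching the table compares a key of size O(M^2) with at most M entries. Both are
    O(M^3). *)
Lemma runs_ins (X : seq bool) (acc : seq entry) (S w : seq (seq bool)) :
  good full acc -> S \in states full ->
  runs insp
    (Node (enc_row X) (Node (enc_seq enc_entry acc) (Node (enc_entry (S, w)) (enc_fam full))))
    (enc_seq enc_entry (insert acc (fam_of full (X :: S), X :: w)))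
    (4500 * M ^ 3).
Proof.
move=> gacc Sst; set S' := fam_of _ _.
have S'k : all (fun X => size X == k) S' by apply: all_state full_k (fam_of_state _ _).
have S'le : size S' <= M := leq_trans (size_state (fam_of_state _ _)) full_le.
have Sle : size S <= M := leq_trans (size_state Sst) full_le.
have acc_le : size acc <= M := leq_trans (size_good gacc) tab_le.
apply: runs_le.
  apply: runs_let.
    apply: runs_then; first exact: runs_ret.
    exact: runs_upd full_k.
  apply: runs_let.
    apply: runs_then; first exact: runs_ret.
    by apply: (@runs_mem _ _ enc_entry (enc_fam \o fst) acc (enc_fam S')).
  apply: runs_then; first exact: runs_ret.
  rewrite /insert fun_if /=.
  have -> : has (fun e : entry => enc_fam S' == enc_fam e.1) acc = (S' \in map fst acc).
    by rewrite -(has_enc _ _ enc_fam_inj) has_map.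
  by apply: (@runs_if _ _ _ _ _ _ 3); ret_le.
have M2 : 0 < M ^ 2 by rewrite expn_gt0 M_gt0.
have := tree_size_fam S'k.
have le1 : size S' * (4 * k + 2) <= M * (6 * M) by apply: leq_mul => //; lia.
have le2 : (size S).+1 * (800 * k + 300) <= (2 * M) * (1100 * M) by apply: leq_mul => //; lia.
have le3 : size full * ((size S).+1 * (800 * k + 300) + 150) <= M * (2350 * M ^ 2).
  by apply: leq_mul => //; lia.
move=> le4.
have le5 : size acc * (tree_size (enc_fam S') * 200 + 100) <= M * (1500 * M ^ 2).
  by apply: leq_mul => //; lia.
by have := leq_mul M_gt0 M2; rewrite /= (expnS M 2); lia.
Qed.

Lemma runs_step row tab :
  size row = k -> good full tab ->
  runs stepp (Node (enc_row row) (Node (enc_seq enc_entry tab) (enc_fam full)))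
    (enc_seq enc_entry (step full tab row)) (5000 * M ^ 5).
Proof.
move=> rowk gtab; have := size_subs row; rewrite rowk => subs_le.
apply: runs_le.
  apply: runs_let.
    by apply: runs_then; [exact: runs_ret | exact: runs_subs].
  apply: runs_then; first exact: runs_ret.
  apply: (@runs_fold _ _ enc_entry (enc_seq enc_entry) _ _
    (Node (enc_fam (subs row)) (enc_fam full)) (4570 * M ^ 4)
    (good full) (fun e => e.1 \in states full) tab [::]) => //; last first.
    by case/andP: gtab => _; rewrite all_map.
  move=> acc [S w] gacc /= Sst; split; first exact: good_candidates.
  rewrite /candidates foldl_map.
  apply: runs_le.
    apply: runs_then; first exact: runs_ret.
    apply: (@runs_fold _ _ enc_row (enc_seq enc_entry) _ _
      (Node (enc_entry (S, w)) (enc_fam full)) (4500 * M ^ 3)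
      (good full) predT (subs row) acc) => //; last exact: all_predT.
    move=> {}acc X {}gacc _; split; first by apply/good_insert => //; apply: fam_of_state.
    exact: runs_ins.
  have := @fold_cost M (size (subs row)) _ 4500 3 M_gt0 (leq_trans subs_le row_le) (leqnn _).
  have : 0 < M ^ 4 by rewrite expn_gt0 M_gt0.
  by rewrite /=; lia.
rewrite rowk.
have := @fold_cost M (size tab) _ 4570 4 M_gt0 (leq_trans (size_good gtab) tab_le) (leqnn _).
have : 0 < M ^ 5 by rewrite expn_gt0 M_gt0.
have : k * (2 ^ k * 100 + 100) <= 200 * M ^ 2 by rewrite expnS expn1; nia.
have := @leq_cost 200 2 5 M M_gt0 isT.
by rewrite /=; lia.
Qed.

End Bounds.

(** * Checking the constraints *)

(* [((sod, q), (r, r'))], where [q] says that the quantifier is universal. *)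
Definition con := ((bool * bool) * (nat * nat))%type.

Definition enc_con (c : con) : tree :=
  Node (Node (enc_bool c.1.1) (enc_bool c.1.2)) (Node (enc_nat c.2.1) (enc_nat c.2.2)).

(* The universal constraints are the negations of existential ones: equality
   and overlap are the two conditions to be detected. *)
Definition hit (c : con) (X : seq bool) : bool :=
  let x := nth false X c.2.1 in
  let y := nth false X c.2.2 in
  if c.1.1 (+) c.1.2 then x (+) y else x && y.

Definition holds (S : seq (seq bool)) (c : con) : bool := c.1.2 (+) has (hit c) S.

(** The numeral drives a fold that drops one bit per unit. Past the end, the head of [Leaf] is
    [Leaf], which encodes the default [false] of [nth]. *)
Definition nthp : proc :=
  andthen (ret (Cons (Hd x0) (Cons (Tl x0) Nil)))
  (andthen (fold (ret (Tl (Hd (Tl x0))))) (ret (Hd x0))).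

Definition xorp : proc :=
  ite (andthen (ret (Cons x0 Nil)) (ite (ret Nil) (ret true_expr))) (ret x0).

Definition andp : proc := ite (ret x0) (ret Nil).

Definition hitp : proc :=
  letp (andthen (ret (Cons (Hd (Tl (Tl (Tl x0)))) (Hd x0))) nthp)
  (letp (andthen (ret (Cons (Tl (Tl (Tl (Tl (Tl x0))))) (Hd (Tl x0)))) nthp)
  (letp (andthen (ret (Hd (Tl (Tl (Tl (Tl x0)))))) xorp)
  (andthen (ret (Cons (Hd x0) (Cons (Hd (Tl (Tl x0))) (Hd (Tl x0)))))
    (ite xorp andp)))).

Definition holdsp : proc :=
  letp (andthen (ret (Cons (Tl (Tl x0)) (Cons Nil (Hd x0))))
    (fold (andthen (ret (Cons (Hd (Tl x0)) x0)) (ite (ret true_expr) hitp))))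
  (andthen (ret (Cons (Tl (Hd (Hd (Tl x0)))) (Hd x0))) xorp).

Definition allp : proc :=
  fold (andthen (ret (Cons (Hd (Tl x0)) x0)) (ite holdsp (ret Nil))).

Definition select (cs : seq con) (acc : option (seq (seq bool))) (e : entry) :=
  if acc is Some _ then acc else if all (holds e.1) cs then Some e.2 else None.

Definition selectp : proc :=
  andthen (ret (Cons (Hd (Tl x0)) x0))
  (ite (ret (Hd (Tl x0)))
    (letp (andthen (ret (Cons (Tl (Tl x0)) (Cons true_expr (Hd (Hd x0))))) allp)
    (andthen (ret (Cons (Hd x0) (Tl (Hd (Tl x0)))))
      (ite (ret (Cons Nil x0)) (ret Nil))))).

Lemma runs_nth r X :
  runs nthp (Node (enc_nat r) (enc_row X)) (enc_bool (nth false X r)) (r * 50 + 50).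
Proof.
rewrite enc_natE.
apply: runs_le.
  apply: runs_then; first exact: runs_ret.
  apply: runs_then.
    apply: (@runs_fold_all _ _ (fun=> Leaf) enc_row (fun a _ => behead a) _ Leaf 5 (nseq r tt) X).
    by case=> [|b a] _; ret_le.
  apply: runs_ret; rewrite /=.
  by elim: r X => [|r IH] [|b X] //=; rewrite IH ?nth_nil.
by rewrite size_nseq /=; lia.
Qed.

Lemma runs_xor a b : runs xorp (Node (enc_bool a) (enc_bool b)) (enc_bool (a (+) b)) 100.
Proof.
apply: runs_le; last shelve.
  apply: (@runs_ite _ _ _ _ _ 50); case: a => /=; last by ret_le.
  apply: runs_le.
    apply: runs_then; first exact: runs_ret.
    by apply: (@runs_ite _ _ _ _ _ 10); case: b => /=; ret_le.
  by [].
Unshelve.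
by [].
Qed.

Lemma runs_and a b : runs andp (Node (enc_bool a) (enc_bool b)) (enc_bool (a && b)) 100.
Proof.
apply: (@runs_le _ _ _ (10 + 22)) => //.
by apply: (@runs_ite _ _ _ _ _ 10); case: a => /=; ret_le.
Qed.

(** In the place of [v] stands the accumulator of the fold in [holdsp]. *)
Lemma runs_hit c X v :
  runs hitp (Node (enc_row X) (Node v (enc_con c))) (enc_bool (hit c X))
    ((c.2.1 + c.2.2) * 50 + 500).
Proof.
apply: runs_le.
  apply: runs_let.
    by apply: runs_then; [exact: runs_ret | exact: runs_nth].
  apply: runs_let.
    by apply: runs_then; [exact: runs_ret | exact: runs_nth].
  apply: runs_let.
    by apply: runs_then; [exact: runs_ret | exact: runs_xor].
  apply: runs_then; first exact: runs_ret.
  rewrite /hit fun_if.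
  by apply: runs_if; [exact: runs_xor | exact: runs_and].
by rewrite /=; lia.
Qed.

Section Bounds.
Variable M : nat.
Hypothesis M_gt0 : 0 < M.

Lemma runs_holds S c v :
  size S <= M -> c.2.1 <= M -> c.2.2 <= M ->
  runs holdsp (Node (enc_con c) (Node v (enc_fam S))) (enc_bool (holds S c))
    (1000 * M ^ 2).
Proof.
move=> SM c1 c2.
apply: runs_le.
  apply: runs_let.
    apply: runs_then; first exact: runs_ret.
    apply: (@runs_fold_all _ _ enc_row enc_bool (fun acc X => acc || hit c X)
      _ (enc_con c) (640 * M ^ 1) S false) => a X.
    apply: (@runs_le _ _ _ (9 + ((600 * M) + 22))); last by rewrite expn1; lia.
    apply: runs_then; first by ret_le.
    apply: runs_ite; case: a => /=; first by ret_le.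
    by apply: runs_le; [exact: runs_hit | lia].
  apply: runs_then; first exact: runs_ret.
  rewrite foldl_has orFb; exact: runs_xor.
have := @fold_cost M (size S) _ 640 1 M_gt0 SM (leqnn _).
have : 0 < M ^ 2 by rewrite expn_gt0 M_gt0.
by rewrite /=; lia.
Qed.

Definition small (c : con) := (c.2.1 <= M) && (c.2.2 <= M).

Lemma runs_all S cs :
  size S <= M -> all small cs ->
  runs allp (Node (enc_seq enc_con cs) (Node (enc_bool true) (enc_fam S)))
    (enc_bool (all (holds S) cs)) (size cs * (1100 * M ^ 2) + 10).
Proof.
move=> SM small_cs.
rewrite -[all _ _]andTb -foldl_all.
apply: runs_le.
  apply: (@runs_fold _ _ enc_con enc_bool _ _ _ (1000 * M ^ 2 + 40)
    (fun=> True) small cs true) => // a c _ /andP[c1 c2]; split=> //.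
  apply: (@runs_le _ _ _ (9 + ((1000 * M ^ 2) + 22))); last by lia.
  apply: runs_then; first by ret_le.
  have M2 : 0 < M ^ 2 by rewrite expn_gt0 M_gt0.
  apply: runs_ite; case: a => /=; last by ret_le.
  exact: runs_holds.
have M2 : 0 < M ^ 2 by rewrite expn_gt0 M_gt0.
by rewrite leq_add2r leq_mul2l; apply/orP; right; lia.
Qed.

(** The number of constraints is not bounded in k, so it remains a separate linear factor; the
    successor pays for the scan of the table when there are none. *)
Lemma runs_select tab cs :
  size tab <= M -> all (fun e : entry => size e.1 <= M) tab -> all small cs ->
  runs (fold selectp)
    (Node (enc_seq enc_entry tab) (Node Leaf (enc_seq enc_con cs)))
    (enc_option enc_fam (foldl (select cs) None tab))
    ((size cs).+1 * (1500 * M ^ 3)).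
Proof.
move=> tabM tabS small_cs.
apply: runs_le.
  apply: (@runs_fold _ _ enc_entry (enc_option enc_fam) _ _ _
    (size cs * (1100 * M ^ 2) + 150)
    (fun=> True) (fun e : entry => size e.1 <= M) tab None) => // acc [S w] _ /= SM.
  split=> //.
  apply: (@runs_le _ _ _ (9 + (size cs * (1100 * M ^ 2) + 100 + 22))); last by lia.
  apply: runs_then; first by ret_le.
  apply: runs_ite; case: acc => [w'|] /=; first by ret_le.
  apply: runs_le.
    apply: runs_let.
      apply: runs_then; first exact: runs_ret.
      exact: runs_all.
    apply: runs_then; first exact: runs_ret.
    rewrite fun_if.
    by apply: (@runs_if _ _ _ _ _ _ 4); ret_le.
  by rewrite /=; lia.
have M2 : 0 < M ^ 2 by rewrite expn_gt0 M_gt0.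
rewrite expnS; have := leq_mul M_gt0 M2.
have := leq_mul tabM (leqnn (size cs * (1100 * M ^ 2) + 150 + 30)).
have := leq_mul (leqnn M) M2.
by lia.
Qed.

End Bounds.

(** * The algorithm *)

(** The constraint (r, r, <->, exists) says that A(r) meets itself, that is, A(r) is nonempty:
    completeness becomes k more constraints. *)
Definition diag (r : nat) : con := ((false, false), (r, r)).

(** The indices are reversed because the program counts upwards while prefixing. *)
Definition add_diag k (cs : seq con) := map diag (rev (iota 0 k)) ++ cs.

Definition diagp : proc :=
  andthen (ret (Cons (Hd x0) (Cons (Cons Nil (Tl x0)) Nil)))
  (andthen (fold (ret (Cons (Cons Nil (Hd (Hd (Tl x0))))
     (Cons (Cons (Cons Nil Nil) (Cons (Hd (Hd (Tl x0))) (Hd (Hd (Tl x0)))))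
           (Tl (Hd (Tl x0)))))))
  (ret (Tl x0))).

Lemma runs_diag k cs :
  runs diagp (Node (enc_nat k) (enc_seq enc_con cs))
    (enc_seq enc_con (add_diag k cs)) (k * 60 + 50).
Proof.
rewrite enc_natE.
apply: runs_le.
  apply: runs_then; first exact: runs_ret.
  apply: runs_then.
    apply: (@runs_fold_all _ _ (fun=> Leaf)
      (fun p : nat * seq con => Node (enc_nat p.1) (enc_seq enc_con p.2))
      (fun p _ => (p.1.+1, diag p.1 :: p.2)) _ Leaf 30 (nseq k tt) (0, cs)) => a _.
    by ret_le.
  apply: runs_ret.
  suff -> : foldl (fun p _ => (p.1.+1, diag p.1 :: p.2)) (0, cs) (nseq k tt)
    = (k, add_diag k cs) by [].
  elim: k => // k; rewrite -[in nseq k.+1 tt]addn1 nseqD foldl_cat => -> /=.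
  by rewrite /add_diag -[in iota 0 k.+1]addn1 iotaD rev_cat.
by rewrite size_nseq /=; lia.
Qed.

Definition fullp : proc :=
  andthen (ret (Cons x0 (Cons Nil Nil)))
  (andthen (fold (ret (Cons true_expr (Hd (Tl x0))))) subsp).

Definition all_rows k := subs (nseq k true).

Lemma runs_full k : runs fullp (enc_nat k) (enc_fam (all_rows k)) (k * (2 ^ k * 100 + 150) + 100).
Proof.
rewrite enc_natE.
apply: runs_le.
  apply: runs_then; first exact: runs_ret.
  apply: runs_then.
    apply: (@runs_fold_all _ _ (fun=> Leaf) enc_row
      (fun a _ => true :: a) _ Leaf 10 (nseq k tt) [::]) => a _.
    by ret_le.
  have -> : foldl (fun a _ => true :: a) [::] (nseq k tt) = nseq k true.
    elim: k => // k; rewrite -[in nseq k.+1 tt]addn1 nseqD foldl_cat => -> //.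
  exact: runs_subs.
by rewrite !size_nseq /=; lia.
Qed.

Definition solve k rows cs :=
  foldl (select (add_diag k cs)) None (table (all_rows k) rows).

Definition solvep : proc :=
  letp (andthen (ret (Tl (Hd x0))) fullp)
  (letp (andthen (ret (Hd (Tl (Tl x0)))) revp)
  (letp (andthen (ret (Cons (Hd x0) (Cons (Cons (Cons Nil Nil) Nil) (Hd (Tl x0))))) (fold stepp))
  (letp (andthen (ret (Cons (Tl (Hd (Tl (Tl (Tl x0))))) (Tl (Tl (Tl (Tl (Tl x0))))))) diagp)
  (andthen (ret (Cons (Hd (Tl x0)) (Cons Nil (Hd x0)))) (fold selectp))))).

Lemma runs_solve (n k : nat) (rows : seq (seq bool)) (cs : seq con) :
  all (fun X => size X == k) rows -> all (small k) cs ->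
  runs solvep
    (Node (Node (enc_nat n) (enc_nat k)) (Node (enc_fam rows) (enc_seq enc_con cs)))
    (enc_option enc_fam (solve k rows cs))
    (100 * 80 * (2 ^ 2 ^ k.+3 * (size rows + size cs + k).+1)).
Proof.
move=> rows_k cs_k; set M := 2 ^ 2 ^ k.
have lt2 m : m < 2 ^ m by apply: ltn_expl.
have M0 : 0 < M by rewrite expn_gt0.
have k2 : 2 ^ k <= M by apply: ltnW.
have kM : k <= M by apply: leq_trans k2; apply: ltnW.
have full2 : size (all_rows k) <= 2 ^ k.
  by rewrite -[X in _ <= 2 ^ X](size_nseq k true) size_subs.
have fullM := leq_trans full2 k2.
have full_pow : 2 ^ size (all_rows k) <= M by rewrite leq_exp2l.
have full_k : all (fun X => size X == k) (all_rows k).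
  by apply/allP=> X; rewrite mem_subs size_nseq => /andP[].
have gt := good_table (all_rows k) rows.
have tabS : all (fun e : entry => size e.1 <= M) (table (all_rows k) rows).
  have /andP[_ /allP st] := gt; apply/allP=> e /(map_f fst) /st /size_state.
  by move/leq_trans; apply.
have small_cs : all (small M) (add_diag k cs).
  rewrite all_cat all_map all_rev; apply/andP; split.
    by apply/allP=> r; rewrite mem_iota /small /= andbb => /ltnW /leq_trans; apply.
  apply: sub_all cs_k => c; rewrite /small => /andP[c1 c2].
  by rewrite !(leq_trans _ kM).
apply: runs_le.
  apply: runs_let.
    by apply: runs_then; [exact: runs_ret | exact: runs_full].
  apply: runs_let.
    by apply: runs_then; [exact: runs_ret | exact: runs_rev].
  apply: runs_let.
    apply: runs_then; first exact: runs_ret.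
    apply: (@runs_fold _ _ enc_row (enc_seq enc_entry) (step (all_rows k)) _ _ (5000 * M ^ 5)
      (good (all_rows k)) (fun X => size X == k) (rev rows) [:: ([::], [::])]).
    - move=> acc X gacc /eqP Xk; split; first exact: good_step.
      exact: (@runs_step k M).
    - exact: good_init.
    - by rewrite all_rev.
  apply: runs_let.
    by apply: runs_then; [exact: runs_ret | exact: runs_diag].
  apply: runs_then; first exact: runs_ret.
  apply: (@runs_select M M0 (table (all_rows k) rows) (add_diag k cs)) => //.
  exact: leq_trans (size_good gt) full_pow.
have -> : 2 ^ 2 ^ k.+3 = M ^ 8 by rewrite -expnM -[k.+3]addn3 expnD.
rewrite size_rev size_cat size_map size_rev size_iota.
set P := M ^ 8.
have pow_le d : d <= 8 -> M ^ d <= P by move=> le; rewrite leq_pexp2l.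
set N := (size rows + size cs + k).+1.
have P0 : 0 < P by rewrite expn_gt0 M0.
clearbody M P.
have c1 : k * (2 ^ k * 100 + 150) <= N * (250 * P).
  by apply: leq_mul; [lia | have := pow_le 1 isT; rewrite expn1; lia].
have c2 : size rows * (5000 * M ^ 5 + 30) <= N * (100 * 51 * P).
  by apply: leq_mul; [lia | have := pow_le 5 isT; lia].
have c3 : (k + size cs).+1 * (1500 * M ^ 3) <= N * (1500 * P).
  by apply: leq_mul; [lia | have := pow_le 3 isT; lia].
have c4 : N <= N * P by rewrite leq_pmulr.
(* The constant 8000 remains a product, as numerals of type [nat] are unary. *)
rewrite [100 * 80 * _]mulnA -[100 * 80 * P]mulnA; set Q := 80 * P.
by rewrite /= /Q; lia.
Qed.

(** * Computability of the double exponential *)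

Definition doublep : proc :=
  andthen (ret (Cons (Hd (Tl x0)) (Cons (Hd (Tl x0)) Nil)))
    (fold (ret (Cons Nil (Hd (Tl x0))))).

Definition pow2p : proc :=
  andthen (ret (Cons x0 (Cons (Cons Nil Nil) Nil))) (fold doublep).

Lemma runs_double n v w :
  runs doublep (Node v (Node (enc_nat n) w)) (enc_nat (n + n)) (n * 60 + 60).
Proof.
have -> : n + n = foldl (fun a (_ : unit) => a.+1) n (nseq n tt).
  suff E m : n + m = foldl (fun a (_ : unit) => a.+1) m (nseq n tt) by [].
  by elim: n m => //= n IH m; rewrite -IH addSnnS.
apply: runs_le.
  apply: runs_then; first exact: runs_ret.
  rewrite /= [X in Node X _]enc_natE.
  apply: (@runs_fold_all _ _ (fun=> Leaf) enc_nat _ _ Leaf 10) => a _.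
  by ret_le.
by rewrite size_nseq /=; lia.
Qed.

Lemma runs_pow2 n : runs pow2p (enc_nat n) (enc_nat (2 ^ n)) (n * (2 ^ n * 60 + 100) + 50).
Proof.
have E m : foldl (fun a (_ : unit) => a + a) m (nseq n tt) = m * 2 ^ n.
  by elim: n m => [|n IH] m /=; rewrite ?muln1 // IH addnn -muln2 expnS mulnA.
rewrite -[in enc_nat (2 ^ n)](mul1n (2 ^ n)) -E.
apply: runs_le.
  apply: runs_then; first exact: runs_ret.
  rewrite /= enc_natE.
  (* The accumulator, doubled once for each remaining unit, stays within 2 ^ n; this bounds the cost
     of every doubling. *)
  apply: (@runs_fold_ind _ _ (fun=> Leaf) enc_nat _ _ Leaf (2 ^ n * 60 + 60)
    (fun t a => a * 2 ^ size t <= 2 ^ n) (nseq n tt) 1); last first.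
    by rewrite size_nseq mul1n.
  move=> _ t a /= le; split; first by rewrite addnn -muln2 -mulnA -expnS.
  apply: runs_le; first exact: runs_double.
  have := leq_mul (leqnn a) (expn_gt0 2 (size t).+1); lia.
by rewrite size_nseq /=; lia.
Qed.

Lemma computable_pow2_pow2 : computable (fun k => 2 ^ 2 ^ k.+3).
Proof.
exists (andthen (ret (Cons Nil (Cons Nil (Cons Nil x0)))) (andthen pow2p pow2p) 0) => k.
have H3 : runs (ret (Cons Nil (Cons Nil (Cons Nil x0)))) (enc_nat k) (enc_nat k.+3) 8.
  exact: runs_ret.
have [t Ht _] := runs_run (runs_then H3 (runs_then (@runs_pow2 k.+3) (@runs_pow2 _))).
by exists t.
Qed.

(** * Correctness *)

Lemma foldl_select cs (tab : seq entry) :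
  match foldl (select cs) None tab with
  | Some w => exists2 S, (S, w) \in tab & all (holds S) cs
  | None => forall e, e \in tab -> ~~ all (holds e.1) cs
  end.
Proof.
have stop w t : foldl (select cs) (Some w) t = Some w by elim: t.
elim: tab => //= [[S w] tab IH]; case: ifP => [ok|/negbT no].
  by rewrite stop; exists S => //; rewrite mem_head.
case: (foldl _ _ _) IH => [w' [S' S'tab ok]|IH e].
  by exists S' => //; rewrite inE S'tab orbT.
by rewrite inE => /predU1P[-> //|/IH].
Qed.

Definition con_of m (c : constraint 'I_m) : con :=
  match c with
  | BoD r r' QExists => ((false, false), (val r, val r'))
  | BoD r r' QForall => ((false, true), (val r, val r'))
  | SoD r r' QExists => ((true, false), (val r, val r'))
  | SoD r r' QForall => ((true, true), (val r, val r'))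
  end.

Section Relations.
Variables n k : nat.
Implicit Types (A B : {set 'I_n * 'I_k}) (w : seq (seq bool)).

Definition row_of A (u : 'I_n) : seq bool := [seq (u, r) \in A | r <- enum 'I_k].

Definition rows_of A : seq (seq bool) := [seq row_of A u | u <- enum 'I_n].

Definition rel_of w : {set 'I_n * 'I_k} :=
  [set p : 'I_n * 'I_k | nth false (nth [::] w p.1) p.2].

Lemma enc_relationE A : enc_relation A = enc_fam (rows_of A).
Proof.
rewrite /enc_fam /rows_of enc_seq_map /enc_relation.
by elim: (enum 'I_n) => //= u s ->; rewrite /enc_row /row_of enc_seq_map.
Qed.

Lemma size_row_of A u : size (row_of A u) = k.
Proof. by rewrite size_map size_enum_ord. Qed.

Lemma size_rows_of A : size (rows_of A) = n.
Proof. by rewrite size_map size_enum_ord. Qed.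

Lemma nth_row_of A u (r : 'I_k) : nth false (row_of A u) r = ((u, r) \in A).
Proof. by rewrite (nth_map r) ?size_enum_ord // nth_ord_enum. Qed.

Lemma nth_rows_of A (u : 'I_n) : nth [::] (rows_of A) u = row_of A u.
Proof. by rewrite (nth_map u) ?size_enum_ord // nth_ord_enum. Qed.

Lemma all_size_rows A : all (fun X => size X == k) (rows_of A).
Proof. by rewrite all_map; apply/allP=> u _; rewrite /= size_row_of. Qed.

Lemma row_of_sub A B u :
  (row_of A u \in subs (row_of B u)) = [forall r, ((u, r) \in A) ==> ((u, r) \in B)].
Proof.
rewrite mem_subs !size_row_of eqxx /row_of /=.
transitivity (all (fun r => ((u, r) \in A) ==> ((u, r) \in B)) (enum 'I_k)).
  by elim: (enum _) => //= r s ->.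
apply/allP/forallP => [H r|H r _]; last exact: H.
by apply: H; rewrite mem_enum.
Qed.

(** Authorization is the only condition that depends on which user owns a row; it is met by
    construction, through the choice of sub-rows. *)
Lemma choice_rows A B : choice_of (rows_of A) (rows_of B) = (A \subset B).
Proof.
transitivity (all (fun u => row_of A u \in subs (row_of B u)) (enum 'I_n)).
  by rewrite /choice_of /rows_of; elim: (enum _) => //= u s ->.
apply/allP/subsetP => [H [u r] uA|H u _].
  by have := H u (mem_enum _ u); rewrite row_of_sub => /forallP/(_ r)/implyP; apply.
by rewrite row_of_sub; apply/forallP=> r; apply/implyP/H.
Qed.

Lemma rel_ofK w : size w = n -> all (fun X => size X == k) w -> rows_of (rel_of w) = w.
Proof.
move=> wn /allP wk; apply: (@eq_from_nth _ [::]); first by rewrite size_rows_of.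
move=> i; rewrite size_rows_of => lt_i; rewrite (nth_rows_of _ (Ordinal lt_i)) /=.
have /wk/eqP sX : nth [::] w i \in w by rewrite mem_nth ?wn.
apply: (@eq_from_nth _ false); first by rewrite size_row_of.
move=> j; rewrite size_row_of => lt_j.
by rewrite (nth_row_of _ _ (Ordinal lt_j)) inE.
Qed.

Lemma choice_of_size w A :
  choice_of w (rows_of A) -> size w = n /\ all (fun X => size X == k) w.
Proof.
rewrite /choice_of => ch; split.
  by move: ch; rewrite all2E size_rows_of => /andP[/eqP].
have := all_size_rows A; elim: w (rows_of A) ch => [|X w IH] [|Y s] //=.
case/andP; rewrite mem_subs => /andP[/eqP -> _] /IH{}IH /andP[-> /IH //].
Qed.

(** Rows of a relation have length k, so filtering [all_rows k] loses none of them. *)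
Lemma has_fam_of (a : pred (seq bool)) A :
  has a (fam_of (all_rows k) (rows_of A)) = [exists u, a (row_of A u)].
Proof.
apply/hasP/existsP => [[X]|[u au]].
  rewrite mem_rev mem_filter => /andP[/mapP[u _ ->] _] au.
  by exists u.
exists (row_of A u) => //; rewrite mem_rev mem_filter map_f ?mem_enum //=.
rewrite mem_subs size_nseq size_row_of eqxx /= -(size_row_of A u).
by elim: (row_of A u) => //= b s ->; rewrite implybT.
Qed.

Lemma users_meet A r r' :
  (users A r :&: users A r' != set0) = [exists u, ((u, r) \in A) && ((u, r') \in A)].
Proof. by apply/set0Pn/existsP => -[u]; rewrite ?inE => H; exists u; rewrite ?inE. Qed.

Lemma users_eq A r r' :
  (users A r == users A r') = ~~ [exists u, ((u, r) \in A) (+) ((u, r') \in A)].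
Proof.
rewrite negb_exists; apply/eqP/forallP => [/setP H u|H].
  by have := H u; rewrite !inE => ->; rewrite addbb.
by apply/setP=> u; have := H u; rewrite !inE; do 2!case: (_ \in _).
Qed.

Lemma holds_con A (c : constraint 'I_k) :
  holds (fam_of (all_rows k) (rows_of A)) (con_of c) = satisfies A c.
Proof.
have E (op : bool -> bool -> bool) (r r' : 'I_k) :
    [exists u, op (nth false (row_of A u) r) (nth false (row_of A u) r')]
    = [exists u, op ((u, r) \in A) ((u, r') \in A)].
  by apply: eq_existsb => u; rewrite !nth_row_of.
rewrite /holds has_fam_of; case: c => r r' [] /=.
- by rewrite users_meet -(E andb).
- by rewrite users_eq -(E addb).
- by rewrite users_eq negbK -(E addb).
- by rewrite -[RHS]negbK users_meet -(E andb).
Qed.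

Lemma holds_diag A : 
  all (holds (fam_of (all_rows k) (rows_of A))) (map diag (iota 0 k)) = complete A.
Proof.
rewrite -val_enum_ord -map_comp all_map /complete.
apply/allP/forallP => [H r|H r _].
  have := H r; rewrite mem_enum => /(_ isT) /=.
  by rewrite -[diag r]/(con_of (BoD r r QExists)) holds_con /= setIid.
by rewrite /= -[diag r]/(con_of (BoD r r QExists)) holds_con /= setIid.
Qed.

Lemma holds_all A (C : seq (constraint 'I_k)) :
  all (holds (fam_of (all_rows k) (rows_of A))) (add_diag k (map (@con_of k) C))
  = complete A && eligible C A.
Proof.
rewrite all_cat map_rev all_rev holds_diag all_map; congr (_ && _).
by apply: eq_all => c; apply: holds_con.
Qed.

End Relations.

Lemma enc_instanceE (x : instance) :
  enc_instance x =
  Node (Node (enc_nat (nb_users x)) (enc_nat (nb_resources x)))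
    (Node (enc_fam (rows_of (base x)))
      (enc_seq enc_con (map (@con_of _) (constraints x)))).
Proof.
rewrite /enc_instance enc_relationE enc_seq_map; congr (Node _ (Node _ _)).
by elim: (constraints x) => //= c s ->; case: c => r r' [].
Qed.

Lemma solveP (x : instance) :
  dapep_answer x (enc_option enc_fam
    (solve (nb_resources x) (rows_of (base x)) (map (@con_of _) (constraints x)))).
Proof.
rewrite /solve.
set cs := add_diag _ _; set tab := table _ _.
have := foldl_select cs tab; case: (foldl _ _ _) => [w [S]|none].
  case/table_sound=> ch -> ok.
  have [wn wk] := choice_of_size ch.
  have wE := rel_ofK wn wk.
  exists (Some (rel_of (nb_users x) (nb_resources x) w)).
    by rewrite /= enc_relationE wE.
  rewrite /valid /authorized -choice_rows wE ch /=.
  by rewrite -wE holds_all in ok.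
exists None => // A; apply/negP=> /and3P[auth comp elig].
(* The table may hold another witness for the family of [A], but acceptance depends on the family
   only. *)
have : choice_of (rows_of A) (rows_of (base x)) by rewrite choice_rows.
case/(table_complete (all_rows (nb_resources x)))/mapP=> e /none /negP no ES; apply: no.
by rewrite -ES holds_all comp elig.
Qed.

Lemma tree_size_nat n : tree_size (enc_nat n) = (2 * n).+1.
Proof. by elim: n => //= n ->; lia. Qed.

Lemma size_enc_seq (T : Type) (enc : T -> tree) s : size s < tree_size (enc_seq enc s).
Proof. by elim: s => //= x s IH; lia. Qed.

Theorem corollary13 : fpt enc_instance nb_resources dapep_answer.
Proof.
exists (solvep 0), (fun k => 2 ^ 2 ^ k.+3), 'X%R, (100 * 80); split.
  exact: computable_pow2_pow2.
move=> x; set rows := rows_of (base x); set cs := map (@con_of _) (constraints x).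
have cs_k : all (small (nb_resources x)) cs.
  rewrite /cs; elim: (constraints x) => //= c s ->; rewrite andbT /small.
  by case: c => r r' []; rewrite /= !(ltnW (ltn_ord _)).
have [t Ht le_t] :=
  runs_run (@runs_solve (nb_users x) _ _ _ (all_size_rows (base x)) cs_k).
rewrite -enc_instanceE in Ht.
exists (enc_option enc_fam (solve (nb_resources x) rows cs)), t.
split; [exact: Ht | exact: solveP |].
apply: leq_trans le_t _; rewrite hornerX.
rewrite leq_mul2l; apply/orP; right; rewrite leq_mul2l; apply/orP; right.
(* The numbers of users and of resources are written in unary, so together with the number of
   constraints they are bounded by the input size. *)
rewrite size_rows_of enc_instanceE /=.
have := size_enc_seq enc_con cs.
by rewrite !tree_size_nat /cs size_map; lia.
Qed.
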